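(* Let $F$ be an arbitrary field and let $\mathcal L=\mathcal L_1\oplus\mathcal L_2\oplus\cdots\oplus\mathcal L_r$ be a direct sum of non-abelian, directly indecomposable, finite-dimensional Lie algebras over $F$. Then $\mathcal L$ satisfies the Central Mixing Property on automorphisms, that is: every Lie algebra automorphism $f$ of $\mathcal L$ factorizes as $f=\theta+\zeta$, where (A) $\theta$ is a Lie algebra automorphism of $\mathcal L$ and there is a unique permutation $\sigma\in\mathcal S_r$ such that $\theta$ maps each summand $\mathcal L_i$ onto an isomorphic summand $\mathcal L_{\sigma(i)}$; and (B) $\zeta$ is a Lie algebra endomorphism of $\mathcal L$ with $\zeta(\mathcal L)\subset Z(\mathcal L)$ and $\pi_{\sigma(i)}(\zeta(\mathcal L_i))=0$ for every $i$. Conversely, for any pair $(\theta,\zeta)$ satisfying (A) and (B), the map $f:=\theta+\zeta$ is a Lie algebra automorphism of $\mathcal L$.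
   Context: $\mathcal S_r$ is the symmetric group on $r$ letters. $\pi_j\colon\mathcal L\to\mathcal L_j$ denotes the projection along the given decomposition and $Z(\mathcal L)$ is the center of $\mathcal L$. A Lie algebra is directly indecomposable if it cannot be written as a direct sum of two non-zero Lie ideals. *)

(* Defs.v *)
From HB Require Import structures.
From mathcomp Require Import all_boot all_order all_algebra all_fingroup.

Set Implicit Arguments.
Unset Strict Implicit.
Unset Printing Implicit Defensive.

Import GRing.Theory.
Local Open Scope ring_scope.

HB.mixin Record Vector_isLieAlgebra (F : fieldType) L of Vector F L := {
  bracket : L -> L -> L;
  bracket_linearl : forall y : L, linear (bracket^~ y);
  bracket_linearr : forall x : L, linear (bracket x);
  bracket_alt : forall x : L, bracket x x = 0;
  bracket_jacobi : forall x y z : L,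
    bracket x (bracket y z) + bracket y (bracket z x)
      + bracket z (bracket x y) = 0
}.

(* Since vectType is the type of finite-dimensional spaces, so are these. *)
#[short(type="lieAlgType")]
HB.structure Definition LieAlgebra (F : fieldType) :=
  {L of Vector_isLieAlgebra F L & Vector F L}.

Section LieDefs.

Context {F : fieldType} {L : lieAlgType F}.
Implicit Types (U V I J : {vspace L}) (f theta zeta : 'End(L)) (r : nat).

(* I is a Lie ideal of the subalgebra U; an ideal of L is the case U = {:L}. *)
Definition lie_ideal U I : Prop :=
  (I <= U)%VS /\ {in U & I, forall x y, bracket x y \in I}.

Definition lie_abelian U : Prop := {in U &, forall x y, bracket x y = 0}.

Definition lie_indecomposable U : Prop :=
  forall I J, lie_ideal U I -> lie_ideal U J ->
    (I + J)%VS = U -> directv (I + J) -> I = 0%VS \/ J = 0%VS.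

Definition lie_central (x : L) : Prop := forall y : L, bracket x y = 0.

Definition lie_endomorphism f : Prop := {morph f : x y / bracket x y}.

Definition lie_automorphism f : Prop := lie_endomorphism f /\ bijective f.

(* A linear map between the subspaces U and V always extends to L, so it is
   represented by an endomorphism of L of which only the values on U matter. *)
Definition lie_isomorphic U V : Prop :=
  exists phi : 'End(L),
    [/\ {in U &, {morph phi : x y / bracket x y}},
        {in U &, injective phi} & (phi @: U)%VS = V].

Definition lie_direct_sum r (Ls : 'I_r -> {vspace L}) : Prop :=
  [/\ forall i, lie_ideal {:L}%VS (Ls i),
      (\sum_(i < r) Ls i)%VS = {:L}%VS & directv (\sum_(i < r) Ls i)].

(* When Ls is a direct decomposition of L, the projection of L onto Ls j with
   kernel the sum of the other summands. *)
Definition lie_proj r (Ls : 'I_r -> {vspace L}) (j : 'I_r) : 'End(L) :=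
  sumv_pi (\sum_(i < r) Ls i)%VS j.

Definition permutes_summands r (Ls : 'I_r -> {vspace L}) theta (s : 'S_r) :
    Prop :=
  forall i, (theta @: Ls i)%VS = Ls (s i) /\ lie_isomorphic (Ls i) (Ls (s i)).

Definition cmp_permuting_part r (Ls : 'I_r -> {vspace L}) theta (s : 'S_r) :
    Prop :=
  lie_automorphism theta /\ unique (permutes_summands Ls theta) s.

Definition cmp_central_part r (Ls : 'I_r -> {vspace L}) zeta (s : 'S_r) :
    Prop :=
  [/\ lie_endomorphism zeta,
      forall x, lie_central (zeta x)
    & forall i, {in Ls i, forall x, lie_proj Ls (s i) (zeta x) = 0}].

End LieDefs.

(* Main.v *)
Require Import Defs.
From HB Require Import structures.
From mathcomp Require Import all_boot all_order all_algebra all_fingroup.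

Set Implicit Arguments.
Unset Strict Implicit.
Unset Printing Implicit Defensive.

Import GRing.Theory.
Local Open Scope ring_scope.

(** Throughout, a central map is one whose values lie in the center Z(L).

The key fact is that a non-abelian, directly indecomposable U has its center
inside [U, U]: otherwise a central line outside [U, U] could be split off U
along a hyperplane containing [U, U] ([center_sub_derived]). It is used twice.

First, a central endomorphism zeta kills every bracket, hence it kills
Z(L_i) for each i and so all of Z(L). If f is an automorphism and
f x + zeta x = 0, then f x is central, so x is central, so zeta x = 0 and
finally x = 0: adding a central endomorphism to an automorphism gives an
automorphism ([automorphism_add_central]). This is the converse direction, and
it also yields the bijectivity of theta = f - zeta in the direct one.

Secondly, suppose that U = A + B with A and B ideals whose brackets with U lie
in NA and NB, where NA and NB meet trivially. The sum need not be direct, but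
the overlap of A and B is central, hence lies in NA + NB. Adding to NA and NB
complements of NA + NB in A and in B, one obtains an honest decomposition
U = A1 + B1 into ideals, so A1 or B1 vanishes, that is, A or B is central in U
([indecomposable_overlap]). Projecting a decomposition L = P + Q to a summand
L_j therefore shows that L_j commutes with P or with Q
([summand_cent_complement]).

Now let f be an automorphism. Applying this to the decomposition of L into the
f(L_i), each L_j fails to commute with exactly one f(L_i); as every f(L_i) is
non-abelian, it fails to commute with at least one L_j. This pairing is the
permutation sigma ([linked_perm]). For k different from sigma(i), the
projection of f(L_i) to L_k is central. So theta is obtained from f by keeping
on L_i only the sigma(i)-component of f, and zeta = f - theta is central. *)

(** * Brackets, centralizers and ideals *)

Section Bracket.

Context {F : fieldType} {L : lieAlgType F}.
Implicit Types (x y z : L) (U V I : {vspace L}) (f g zeta : 'End(L)).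

HB.instance Definition _ x :=
  GRing.isLinear.Build F L L *:%R (bracket x) (bracket_linearr x).

Lemma bracketC x y : bracket x y = - bracket y x.
Proof.
have linl z : linear (bracket^~ z : L -> L) by apply: bracket_linearl.
have addl u v z : bracket (u + v) z = bracket u z + bracket v z :> L.
  by have := linl z 1 u v; rewrite !scale1r.
apply/eqP; rewrite -subr_eq0 opprK.
have := bracket_alt (x + y).
by rewrite addl !linearD /= !bracket_alt addr0 add0r => ->.
Qed.

Lemma bracketDl x y z : bracket (x + y) z = bracket x z + bracket y z.
Proof. by rewrite bracketC linearD opprD -!bracketC. Qed.

Lemma bracketNl x y : bracket (- x) y = - bracket x y.
Proof. by rewrite bracketC linearN opprK bracketC opprK. Qed.

Lemma bracket_central_r x y : lie_central x -> bracket y x = 0.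
Proof. by move=> cx; rewrite bracketC cx oppr0. Qed.

(** The centralizer of U is a decidable object: it is computed on a basis of
U, so that commutation of two subspaces becomes a boolean inclusion. *)
Definition lie_cent U : {vspace L} :=
  (\bigcap_(i < \dim U) lker (linfun (bracket (vbasis U)`_i)))%VS.

Lemma lie_centP U y :
  reflect {in U, forall x, bracket x y = 0} (y \in lie_cent U).
Proof.
rewrite memvE; apply: (iffP subv_bigcapP) => [cy x Ux | cy i _].
  rewrite bracketC (coord_vbasis Ux) linear_sum big1 ?oppr0 // => i _.
  have := cy i isT; rewrite -memvE memv_ker lfunE /= => /eqP cyi.
  by rewrite linearZ /= bracketC cyi oppr0 scaler0.
by rewrite -memvE memv_ker lfunE /= cy // vbasis_mem // mem_nth ?size_tuple.
Qed.

Lemma sub_lie_centP U V :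
  reflect {in U & V, forall x y, bracket x y = 0} (V <= lie_cent U)%VS.
Proof.
apply: (iffP subvP) => [cUV x y Ux /cUV/lie_centP-> // | cUV y Vy].
by apply/lie_centP=> x Ux; apply: cUV.
Qed.

Lemma lie_cent_sym U V : (V <= lie_cent U)%VS = (U <= lie_cent V)%VS.
Proof.
by apply/sub_lie_centP/sub_lie_centP=> c x y Ux Vy; rewrite bracketC c ?oppr0.
Qed.

Lemma lie_centralP x : reflect (lie_central x) (x \in lie_cent fullv).
Proof.
apply: (iffP (lie_centP _ _)) => [cx y | cx y _].
  by rewrite bracketC cx ?memvf ?oppr0.
exact: bracket_central_r.
Qed.

Lemma lie_ideal_sum r (P : pred 'I_r) (Ms : 'I_r -> {vspace L}) :
  (forall i, lie_ideal fullv (Ms i)) -> lie_ideal fullv (\sum_(i | P i) Ms i).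
Proof.
move=> idM; split=> [|x y _ /memv_sumP[ys Mys ->]]; first exact: subvf.
rewrite linear_sum memv_sumr // => i Pi.
by have [_] := idM i; apply; rewrite ?memvf ?Mys.
Qed.

Lemma lie_automorphism_lker f : lie_automorphism f -> lker f == 0%VS.
Proof. by case=> _ /bij_inj injf; apply/lker0P. Qed.

Lemma lie_endomorphism_auto f :
  lie_endomorphism f -> lker f == 0%VS -> lie_automorphism f.
Proof.
move=> endf kf; split=> //.
by exists f^-1%VF; [apply: lker0_lfunK | apply: lker0_lfunVK].
Qed.

Lemma lie_ideal_img f I :
  lie_automorphism f -> lie_ideal fullv I -> lie_ideal fullv (f @: I)%VS.
Proof.
move=> [endf [g _ fK]] [_ idI]; split=> [|x _ _ /memv_imgP[y Iy ->]].
  exact: subvf.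
by rewrite -(fK x) -endf memv_img ?idI ?memvf.
Qed.

End Bracket.

(** * Indecomposable non-abelian Lie algebras *)

Section Indecomposable.

Context {F : fieldType} {L : lieAlgType F}.
Variable U : {vspace L}.
Hypotheses (nabU : ~ lie_abelian U) (indU : lie_indecomposable U).

(** D is any subspace of U containing [U, U]. If z were central and
outside D, some complement H of the line of z would contain D; both H and the
line are then ideals of U, so U would be the line itself, which is abelian. *)
Lemma center_sub_derived (D : {vspace L}) z :
    (D <= U)%VS -> {in U &, forall x y, bracket x y \in D} ->
    z \in U -> {in U, forall x, bracket x z = 0} -> z \in D.
Proof.
move=> sDU derD Uz cz; apply/negPn/negP=> nDz.
(* H is kept abstract because directv reads off the syntax of its argument,
   and would otherwise see through the inner sum. *)
have [H defH] : {H | H = D + (U :\: (D + <[z]>))}%VS by eexists.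
have szU : (<[z]> <= U)%VS by rewrite -memvE.
have sHU : (H <= U)%VS by rewrite defH subv_add sDU diffvSl.
have HzU : (H + <[z]>)%VS = U.
  rewrite defH addvC addvA [(<[z]> + D)%VS]addvC addvC addv_diff.
  by apply/addv_idPl; rewrite subv_add sDU.
have nHz : z \notin H.
  rewrite defH; apply/memv_addP=> -[d Dd [w Ww zE]]; case/negP: nDz.
  suffices w0 : w = 0 by rewrite zE w0 addr0.
  apply/eqP; rewrite -memv0 -(capv_diff U (D + <[z]>)%VS) memv_cap Ww /=.
  rewrite (_ : w = - d + z); last by rewrite zE addKr.
  by rewrite memv_add ?memvN ?memv_line.
have idH : lie_ideal U H.
  split=> // x y Ux Hy; rewrite defH; apply: (subvP (addvSl _ _)).
  by rewrite derD // (subvP sHU).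
have idz : lie_ideal U <[z]>.
  by split=> // x _ Ux /vlineP[k ->]; rewrite linearZ /= cz // scaler0 mem0v.
have dirHz : directv (H + <[z]>).
  apply/directv_addP; apply/eqP; rewrite -subv0; apply/subvP=> w.
  rewrite memv_cap => /andP[Hw /vlineP[k wE]]; rewrite memv0 wE.
  have [-> | k0] := eqVneq k 0; first by rewrite scale0r.
  by case/negP: nHz; rewrite -(scalerK k0 z) -wE memvZ.
case: (indU idH idz HzU dirHz) => [H0 | z0].
  case: nabU => x y Ux; rewrite -{1}HzU H0 add0v => /vlineP[k ->].
  by rewrite linearZ /= cz ?scaler0.
case/negP: nDz; have := memv_line z.
by rewrite z0 memv0 => /eqP->; apply: mem0v.
Qed.

(** The sum A + B is made direct without changing NA and NB: what A and B
share is central in U, hence lies in D = NA + NB, which contains [U, U]; so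
A and B become independent modulo D, and it suffices to replace A by NA plus a
complement of D in A, and likewise for B. *)
Lemma indecomposable_overlap (A B NA NB : {vspace L}) :
    (A + B)%VS = U -> (NA <= A)%VS -> (NB <= B)%VS -> (NA :&: NB)%VS = 0%VS ->
    {in U & A, forall x y, bracket x y \in NA} ->
    {in U & B, forall x y, bracket x y \in NB} ->
  (A <= lie_cent U)%VS \/ (B <= lie_cent U)%VS.
Proof.
move=> ABU sNA sNB NAB0 derA derB; set D := (NA + NB)%VS.
have [sAU sBU] : (A <= U)%VS /\ (B <= U)%VS by rewrite -ABU addvSl addvSr.
have sDU : (D <= U)%VS by rewrite -ABU addvS.
have derD : {in U &, forall x y, bracket x y \in D}.
  move=> x y Ux; rewrite -{1}ABU => /memv_addP[a Aa [b Bb ->]].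
  by rewrite linearD memv_add ?derA ?derB.
have sABD : (A :&: B <= D)%VS.
  apply/subvP=> z; rewrite memv_cap => /andP[Az Bz].
  apply: center_sub_derived derD _ _ => // [|x Ux]; first exact: (subvP sAU).
  by apply/eqP; rewrite -memv0 -NAB0 memv_cap derA ?derB.
(* A1 and B1 are abstract for the sake of directv, as above. *)
have [A1 defA1] : {A1 | A1 = NA + (A :\: D)}%VS by eexists.
have [B1 defB1] : {B1 | B1 = NB + (B :\: D)}%VS by eexists.
have sA1 : (A1 <= A)%VS by rewrite defA1 subv_add sNA diffvSl.
have sB1 : (B1 <= B)%VS by rewrite defB1 subv_add sNB diffvSl.
have sum1 : (A1 + B1)%VS = U.
  rewrite defA1 defB1 [LHS](Monoid.mulmACA (@addv _ _)) /= -/D.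
  rewrite (addvC D) -addvA addv_diff (addvC B) addvA addv_diff.
  by rewrite -addvA (addvC D) addvA ABU; apply/addv_idPl.
have dir1 : directv (A1 + B1).
  apply/directv_addP; apply/eqP; rewrite -subv0; apply/subvP=> x.
  rewrite defA1 defB1 memv_cap => /andP[/memv_addP[a Na [v Vv ->]]].
  case/memv_addP=> b Nb [w Ww eq_avbw].
  have Av : v \in A := subvP (diffvSl _ _) _ Vv.
  have Bw : w \in B := subvP (diffvSl _ _) _ Ww.
  have Da : a \in D := subvP (addvSl _ _) _ Na.
  have Db : b \in D := subvP (addvSr _ _) _ Nb.
  have Dw : w \in D.
    have cap : a + v \in (A :&: B)%VS.
      rewrite memv_cap {2}eq_avbw; apply/andP.
      by split; apply: memvD; rewrite // ?(subvP sNA) ?(subvP sNB).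
    have: a + v - b \in D by rewrite memvB // (subvP sABD).
    by rewrite eq_avbw addrC addKr.
  have Dv : v \in D.
    have: a + v - a \in D by rewrite memvB // eq_avbw memvD.
    by rewrite addrC addKr.
  have v0 : v = 0.
    by apply/eqP; rewrite -memv0 -(capv_diff A D) memv_cap Vv.
  have w0 : w = 0.
    by apply/eqP; rewrite -memv0 -(capv_diff B D) memv_cap Ww.
  by move: eq_avbw; rewrite v0 w0 !addr0 -NAB0 memv_cap Na => ->.
have id1 : lie_ideal U A1.
  split=> [|x y Ux A1y]; first exact: subv_trans sAU.
  by rewrite defA1; apply: (subvP (addvSl _ _)); rewrite derA // (subvP sA1).
have id2 : lie_ideal U B1.
  split=> [|x y Ux B1y]; first exact: subv_trans sBU.
  by rewrite defB1; apply: (subvP (addvSl _ _)); rewrite derB // (subvP sB1).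
have sub0 N V : (N + V)%VS = 0%VS -> N = 0%VS.
  by move=> NV0; apply/eqP; rewrite -subv0 -NV0 addvSl.
case: (indU id1 id2 sum1 dir1); rewrite ?defA1 ?defB1 => /sub0 N0;
  [left | right]; apply/sub_lie_centP=> x y Ux Vy; apply/eqP; rewrite -memv0 -N0.
  exact: derA.
exact: derB.
Qed.

End Indecomposable.

(** * Direct decompositions *)

Section Decomposition.

Context {F : fieldType} {L : lieAlgType F}.
Variables (r : nat) (Ls : 'I_r -> {vspace L}).
Hypothesis Ls_dsum : lie_direct_sum Ls.
Hypothesis Ls_nonabelian : forall i, ~ lie_abelian (Ls i).
Hypothesis Ls_indecomposable : forall i, lie_indecomposable (Ls i).

Let p := lie_proj Ls.

Lemma lie_proj_mem i x : p i x \in Ls i.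
Proof. exact: memv_sum_pi. Qed.

Lemma lie_proj_sum x : \sum_i p i x = x.
Proof.
by apply: sumv_pi_sum; case: Ls_dsum => _ defL _; rewrite defL memvf.
Qed.

Lemma lie_proj_summand i j x : x \in Ls i -> p j x = if j == i then x else 0.
Proof.
move=> Lx; case: Ls_dsum => _ _ /directv_sum_unique.
move/(_ (fun j => p j x) (fun j => if j == i then x else 0)).
rewrite lie_proj_sum -big_mkcond big_pred1_eq eqxx => uniqx.
apply/eqP/(forallP (esym (uniqx _ _))) => // k _; first exact: lie_proj_mem.
by case: eqP => [-> | _]; rewrite ?mem0v.
Qed.

Lemma summand_capv i j : i != j -> (Ls i :&: Ls j)%VS = 0%VS.
Proof.
move=> neq_ij; apply/eqP; rewrite -subv0; apply/subvP=> x.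
rewrite memv_cap memv0 => /andP[Lix Ljx].
have := lie_proj_summand j Ljx.
by rewrite (lie_proj_summand j Lix) eqxx eq_sym (negbTE neq_ij) => <-.
Qed.

Lemma bracket_summandr i x y : y \in Ls i -> bracket x y \in Ls i.
Proof. by case: Ls_dsum => /(_ i)[_ idL] _ _; apply: idL; rewrite memvf. Qed.

Lemma bracket_summandl i x y : x \in Ls i -> bracket x y \in Ls i.
Proof. by move=> Lx; rewrite bracketC memvN bracket_summandr. Qed.

Lemma bracket_summands i j x y :
  i != j -> x \in Ls i -> y \in Ls j -> bracket x y = 0.
Proof.
move=> /summand_capv cap0 Lx Ly; apply/eqP.
by rewrite -memv0 -cap0 memv_cap bracket_summandl ?bracket_summandr.
Qed.

(** The components of y outside Ls i do not contribute, since distinct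
summands commute. *)
Lemma bracket_proj i x y : x \in Ls i -> bracket x (p i y) = bracket x y.
Proof.
move=> Lx; rewrite -[in RHS](lie_proj_sum y) linear_sum (bigD1 i) //=.
rewrite big1 ?addr0 // => j neq_ji.
by apply: (@bracket_summands i j); rewrite ?lie_proj_mem // eq_sym.
Qed.

Lemma proj_central i (V : {vspace L}) :
  (V <= lie_cent (Ls i))%VS -> forall x, x \in V -> lie_central (p i x).
Proof.
move=> /sub_lie_centP cV x Vx; apply/lie_centralP/lie_centP=> y _.
rewrite -(lie_proj_sum y) bracketC linear_sum big1 ?oppr0 // => j _.
have [-> | neq_ij] := eqVneq j i; last first.
  by apply: (@bracket_summands i j); rewrite ?lie_proj_mem // eq_sym.
by rewrite /= bracketC bracket_proj ?lie_proj_mem // cV ?oppr0 ?lie_proj_mem.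
Qed.

(** The projections of P and Q span Ls j but may overlap. Their brackets with
Ls j are those of P and Q themselves, hence lie in Ls j :&: P and Ls j :&: Q,
which are independent: this is the situation of [indecomposable_overlap]. *)
Lemma summand_cent_complement j (P Q : {vspace L}) :
    lie_ideal fullv P -> lie_ideal fullv Q ->
    (P + Q)%VS = fullv -> (P :&: Q)%VS = 0%VS ->
  (P <= lie_cent (Ls j))%VS \/ (Q <= lie_cent (Ls j))%VS.
Proof.
move=> [_ idP] [_ idQ] PQ cap0.
have capS (I : {vspace L}) : (Ls j :&: I <= p j @: I)%VS.
  apply/subvP=> x; rewrite memv_cap => /andP[Lx Ix]; apply/memv_imgP.
  by exists x; rewrite // (lie_proj_summand _ Lx) eqxx.
have der (I : {vspace L}) : {in fullv & I, forall x y, bracket x y \in I} ->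
    {in Ls j & (p j @: I)%VS, forall x y, bracket x y \in (Ls j :&: I)%VS}.
  move=> idI x _ Lx /memv_imgP[y Iy ->].
  by rewrite bracket_proj // memv_cap bracket_summandl ?idI ?memvf.
have cent (I : {vspace L}) :
    (p j @: I <= lie_cent (Ls j))%VS -> (I <= lie_cent (Ls j))%VS.
  move=> /sub_lie_centP cI; apply/sub_lie_centP=> x y Lx Iy.
  by rewrite -(bracket_proj y Lx) cI ?memv_img.
have imgPQ : (p j @: P + p j @: Q)%VS = Ls j.
  rewrite -limgD PQ; apply/eqP; rewrite eqEsubv; apply/andP; split.
    by apply/subvP=> _ /memv_imgP[x _ ->]; apply: lie_proj_mem.
  apply/subvP=> x Lx; apply/memv_imgP.
  by exists x; rewrite ?memvf // (lie_proj_summand _ Lx) eqxx.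
have NPQ0 : ((Ls j :&: P) :&: (Ls j :&: Q))%VS = 0%VS.
  apply/eqP; rewrite -subv0 -cap0; apply/subvP=> x.
  by rewrite !memv_cap => /andP[/andP[_ ->] /andP[_ ->]].
have [] := indecomposable_overlap (@Ls_nonabelian j) (@Ls_indecomposable j)
  imgPQ (capS P) (capS Q) NPQ0 (der P idP) (der Q idQ).
  by move/cent; left.
by move/cent; right.
Qed.

(** Being an endomorphism with central values, zeta vanishes on brackets,
hence by [center_sub_derived] on the center of each Ls i; the kernel of g + zeta consists of central
elements, on which g + zeta is thus the injective map g. *)
Lemma automorphism_add_central (g zeta : 'End(L)) :
    lie_automorphism g -> lie_endomorphism zeta ->
    (forall x, lie_central (zeta x)) ->
  lie_automorphism (g + zeta).
Proof.
move=> autg endz cz; have [endg _] := autg.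
have z0 x y : zeta (bracket x y) = 0 by rewrite endz cz.
have ker_cent x : (g + zeta) x = 0 -> lie_central x.
  rewrite add_lfunE => /eqP; rewrite addr_eq0 => /eqP gx y.
  have /lker0P injg := lie_automorphism_lker autg; apply: injg.
  by rewrite endg gx linear0 bracketNl cz oppr0.
have z_cent x : lie_central x -> zeta x = 0.
  move=> cx; rewrite -(lie_proj_sum x) linear_sum big1 // => i _.
  apply/eqP; rewrite -memv_ker.
  apply: (subvP (capvSr (Ls i) _)).
  apply: (@center_sub_derived _ _ (Ls i)) => // [|u v Lu Lv||u Lu].
  - exact: capvSl.
  - by rewrite memv_cap bracket_summandl //= memv_ker z0.
  - exact: lie_proj_mem.
  - by rewrite bracket_proj // bracketC cx oppr0.
apply: lie_endomorphism_auto => [x y|].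
  rewrite !add_lfunE z0 addr0 endg bracketDl cz addr0 linearD /=.
  by rewrite (bracket_central_r _ (cz y)) addr0.
rewrite -subv0; apply/subvP=> x; rewrite memv_ker memv0 => /eqP fx0.
have := fx0; rewrite add_lfunE z_cent ?addr0; last exact: ker_cent.
move=> gx0; have /lker0P injg := lie_automorphism_lker autg.
by apply/eqP/injg; rewrite gx0 linear0.
Qed.

Section Factorization.

Variable f : 'End(L).
Hypothesis autf : lie_automorphism f.

Lemma img_summands_full : (\sum_i f @: Ls i)%VS = fullv.
Proof.
have [_ defL _] := Ls_dsum; rewrite -limg_sum defL.
exact/lker0_limgf/lie_automorphism_lker.
Qed.

Lemma img_summand_nonabelian i : ~ lie_abelian (f @: Ls i)%VS.
Proof.
move=> abM; apply: (@Ls_nonabelian i) => x y Lx Ly.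
have /lker0P injf := lie_automorphism_lker autf; apply: injf.
by have [endf _] := autf; rewrite endf abM ?linear0 ?memv_img.
Qed.

Definition linked i j := ~~ (f @: Ls i <= lie_cent (Ls j))%VS.

Lemma linked_exl j : exists i, linked i j.
Proof.
apply/existsP; rewrite -negb_forall; apply/negP=> /forallP cL.
apply: (@Ls_nonabelian j) => x y Lx _.
have: (fullv <= lie_cent (Ls j))%VS.
  by rewrite -img_summands_full; apply/subv_sumP=> i _; apply: cL.
by move/sub_lie_centP; apply; rewrite ?memvf.
Qed.

Lemma linked_exr i : exists j, linked i j.
Proof.
apply/existsP; rewrite -negb_forall; apply/negP=> /forallP cL.
apply: (@img_summand_nonabelian i) => x y Mx _.
have: (fullv <= lie_cent (f @: Ls i))%VS.
  have [_ defL _] := Ls_dsum; rewrite -defL; apply/subv_sumP=> j _.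
  by rewrite lie_cent_sym; apply: cL.
by move/sub_lie_centP; apply; rewrite ?memvf.
Qed.

(** Ls j commutes with f (Ls i) or with the image of the complementary sum, to
which f (Ls k) belongs when k differs from i. *)
Lemma linked_uniql i k j : linked i j -> linked k j -> k = i.
Proof.
move=> mij mkj; apply/eqP/negPn/negP => neq_ki.
pose Q := (\sum_(l | l != i) Ls l)%VS.
have [idL sumL /directv_sumP dirL] := Ls_dsum.
have kf := lie_automorphism_lker autf.
case: (@summand_cent_complement j (f @: Ls i) (f @: Q)).
- exact: lie_ideal_img.
- exact/lie_ideal_img/lie_ideal_sum.
- rewrite -limgD -[RHS](lker0_limgf kf) -sumL.
  by congr (_ @: _)%VS; rewrite [RHS](bigD1 i).
- by rewrite -lker0_img_cap // dirL // limg0.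
- exact/negP.
- apply/negP; apply: contra mkj; apply: subv_trans.
  by rewrite limgS // (sumv_sup k).
Qed.

(** Each j is linked to a single i, which defines a map t; t is onto because
each i is linked to some j, so t is a permutation of the finite index set and
s is its inverse. *)
Lemma linked_perm : exists s : 'S_r, forall i j, j != s i -> ~~ linked i j.
Proof.
pose t j := xchoose (linked_exl j).
have tP j : linked (t j) j := xchooseP (linked_exl j).
have t_surj i : exists j, t j == i.
  have [j mij] := linked_exr i; exists j; apply/eqP.
  exact: linked_uniql mij (tP j).
pose s i := xchoose (t_surj i).
have sK : cancel s t by move=> i; apply/eqP/(xchooseP (t_surj i)).
exists (perm (can_inj sK)) => i j; rewrite permE; apply: contra => mij.
have tj : t j = i by apply: linked_uniql mij (tP j).
have [s' _ sK'] := injF_bij (can_inj sK).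
by rewrite -tj -(sK' j) sK.
Qed.

Lemma central_mixing :
  exists (theta zeta : 'End(L)) (s : 'S_r),
    [/\ f = theta + zeta, cmp_permuting_part Ls theta s
      & cmp_central_part Ls zeta s].
Proof.
have [endf _] := autf; have [s sP] := linked_perm.
pose theta : 'End(L) := (\sum_i (p (s i) \o f \o p i))%VF.
pose zeta := f - theta.
have thetaE i x : x \in Ls i -> theta x = p (s i) (f x).
  move=> Lx; rewrite sum_lfunE (bigD1 i) //= big1 => [|j neq_ji].
    by rewrite !comp_lfunE (lie_proj_summand _ Lx) eqxx addr0.
  by rewrite !comp_lfunE (lie_proj_summand _ Lx) (negbTE neq_ji) !linear0.
have zetaE x : zeta x = f x - theta x by rewrite add_lfunE opp_lfunE.
have zeta_summand i x : x \in Ls i -> lie_central (zeta x).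
  move=> Lx; rewrite zetaE (thetaE i) //.
  have -> : f x - p (s i) (f x) = \sum_(j | j != s i) p j (f x).
    by rewrite -[X in X - _]lie_proj_sum (bigD1 (s i)) //= [LHS]addrC addKr.
  apply/lie_centralP/rpred_sum=> j neq_js; apply/lie_centralP.
  apply: (@proj_central _ (f @: Ls i)%VS); last exact: memv_img.
  by have := sP i j neq_js; rewrite negbK.
have cz x : lie_central (zeta x).
  apply/lie_centralP; rewrite -(lie_proj_sum x) linear_sum.
  apply: rpred_sum => i _; apply/lie_centralP/(zeta_summand i)/lie_proj_mem.
have z0 x y : zeta (bracket x y) = 0.
  rewrite -(lie_proj_sum y) !linear_sum big1 // => i _.
  have Ly := lie_proj_mem i y; move: (p i y) Ly => u Lu /=.
  rewrite zetaE (thetaE i) ?bracket_summandr //.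
  (* f (bracket x u) already lies in Ls (s i), so projecting it there does
     not change it. *)
  have fxu : f (bracket x u) = bracket (f x) (theta u).
    rewrite endf -[in LHS](subrK (theta u) (f u)) linearD -zetaE /=.
    by rewrite bracket_central_r ?add0r //; apply: cz.
  have Lf : f (bracket x u) \in Ls (s i).
    by rewrite fxu bracket_summandr // (thetaE i) ?lie_proj_mem.
  by rewrite (lie_proj_summand _ Lf) eqxx subrr.
have endz : lie_endomorphism zeta by move=> x y; rewrite z0 cz.
have ftz : f = theta + zeta by rewrite /zeta addrC subrK.
have autt : lie_automorphism theta.
  have -> : theta = f + - zeta by rewrite /zeta opprB addrC subrK.
  have endNz : lie_endomorphism (- zeta).
    by move=> x y; rewrite !opp_lfunE z0 bracketNl cz.
  apply: automorphism_add_central => // x y.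
  by rewrite opp_lfunE bracketNl cz oppr0.
have imgt i : (theta @: Ls i)%VS = Ls (s i).
  apply/eqP; rewrite eqEsubv; apply/andP; split; apply/subvP.
    by move=> _ /memv_imgP[x Lx ->]; rewrite (thetaE i) ?lie_proj_mem.
  move=> y Ly; have: y \in limg theta.
    by rewrite lker0_limgf ?memvf ?lie_automorphism_lker.
  (* Only the component of x in Ls i contributes to the component of theta x
     in Ls (s i). *)
  case/memv_imgP=> x _ yE; apply/memv_imgP.
  exists (p i x); first exact: lie_proj_mem.
  have := lie_proj_summand (s i) Ly; rewrite eqxx => <-.
  rewrite yE -{1}(lie_proj_sum x) !linear_sum (bigD1 i) //= big1 => [|j neq_ji].
    rewrite (thetaE i) ?lie_proj_mem // addr0.
    by rewrite (lie_proj_summand _ (lie_proj_mem _ _)) eqxx.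
  rewrite (thetaE j) ?lie_proj_mem // (lie_proj_summand _ (lie_proj_mem _ _)).
  by rewrite (inj_eq perm_inj) eq_sym (negbTE neq_ji).
exists theta, zeta, s; split=> //.
  split=> //; split=> [i | s' s'P].
    split=> //; exists theta; split=> //; first by move=> x y _ _; case: autt.
    by move=> x y _ _; have /lker0P := lie_automorphism_lker autt; apply.
  apply/permP=> i; apply/eqP/negPn/negP=> /summand_capv.
  have [<- _] := s'P i; rewrite imgt capvv => L0.
  apply: (@Ls_nonabelian (s i)) => x y; rewrite L0 memv0 => /eqP-> _.
  by rewrite bracketC linear0 oppr0.
split=> // i x Lx; rewrite zetaE (thetaE i) // linearB /=.
by rewrite -/p [X in _ - X](lie_proj_summand _ (lie_proj_mem _ _)) eqxx subrr.
Qed.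

End Factorization.

End Decomposition.

Theorem theorem1p3 (F : fieldType) (L : lieAlgType F) (r : nat)
    (Ls : 'I_r -> {vspace L})
    (Ls_dsum : lie_direct_sum Ls)
    (Ls_nonabelian : forall i : 'I_r, ~ lie_abelian (Ls i))
    (Ls_indecomposable : forall i : 'I_r, lie_indecomposable (Ls i)) :
  (forall f : 'End(L), lie_automorphism f ->
     exists (theta zeta : 'End(L)) (sigma : 'S_r),
       [/\ f = theta + zeta,
           cmp_permuting_part Ls theta sigma
         & cmp_central_part Ls zeta sigma]) /\
  (forall (theta zeta : 'End(L)) (sigma : 'S_r),
     cmp_permuting_part Ls theta sigma -> cmp_central_part Ls zeta sigma ->
     lie_automorphism (theta + zeta)).
Proof.
split=> [f | theta zeta sigma [autt _] [endz cz _]]; first exact: central_mixing.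
exact: (automorphism_add_central Ls_dsum).
Qed.
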